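(* Let $\mathcal{I}$ be an operator ideal. The following are equivalent: (a) $\mathcal{I}$ is an injective operator ideal. (b) $\mathcal{I}\circ\mathcal{P}$ is an injective polynomial hyper-ideal. (c) $(\mathcal{I}\circ\mathcal{P})_m$ is an injective ideal of $m$-homogeneous polynomials for some $m\in\mathbb{N}$.
   Context: All Banach spaces are over $\mathbb{K}=\mathbb{R}$ or $\mathbb{C}$. For Banach spaces $E,F$ and $m\in\mathbb{N}$, $\mathcal{L}(E;F)$ is the space of bounded linear operators and $\mathcal{P}(^mE;F)$ the space of continuous $m$-homogeneous polynomials from $E$ to $F$; $\mathcal{P}$ is the class of all continuous homogeneous polynomials between Banach spaces. Polynomials of finite type are the finite sums $x\mapsto\sum_i \varphi_i(x)^m y_i$ with $\varphi_i\in E^*$, $y_i\in F$. An operator ideal (in the sense of Pietsch) is a subclass $\mathcal{I}$ of the class of bounded linear operators between Banach spaces such that each component $\mathcal{I}(E;F)=\mathcal{L}(E;F)\cap\mathcal{I}$ is a linear subspace of $\mathcal{L}(E;F)$ containing the finite rank operators, and $t\circ v\circ u\in\mathcal{I}(E;H)$ whenever $t\in\mathcal{L}(G;H)$, $v\in\mathcal{I}(F;G)$, $u\in\mathcal{L}(E;F)$. A polynomial ideal is a class $\mathcal{Q}$ of continuous homogeneous polynomials between Banach spaces such that each component $\mathcal{Q}(^mE;F):=\mathcal{P}(^mE;F)\cap\mathcal{Q}$ is a linear subspace of $\mathcal{P}(^mE;F)$ containing the polynomials of finite type, and $t\circ P\circ u\in\mathcal{Q}(^mE;H)$ whenever $t\in\mathcal{L}(G;H)$,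 $P\in\mathcal{Q}(^mF;G)$, $u\in\mathcal{L}(E;F)$. It is a polynomial hyper-ideal if moreover $t\circ P\circ Q\in\mathcal{Q}(^{mn}E;H)$ whenever $t\in\mathcal{L}(G;H)$, $P\in\mathcal{Q}(^mF;G)$, $Q\in\mathcal{P}(^nE;F)$. The $m$-th component $\mathcal{Q}_m=\bigcup_{E,F}\mathcal{Q}(^mE;F)$ of a polynomial ideal $\mathcal{Q}$ is called an ideal of $m$-homogeneous polynomials. Composition ideal: $P\in\mathcal{P}(^mE;F)$ belongs to $\mathcal{I}\circ\mathcal{P}(^mE;F)$ if there are a Banach space $G$, a polynomial $Q\in\mathcal{P}(^mE;G)$ and an operator $u\in\mathcal{I}(G;F)$ such that $P=u\circ Q$. It is well known that $\mathcal{I}\circ\mathcal{P}$ is a polynomial hyper-ideal. A metric injection is a linear operator $j\colon F\to G$ with $\|j(y)\|=\|y\|$ for all $y\in F$. A polynomial ideal (or hyper-ideal) $\mathcal{Q}$ is injective if, for every $m$ and all $E,F,G$, $P\in\mathcal{Q}(^mE;F)$ whenever $P\in\mathcal{P}(^mE;F)$ and $j\colon F\to G$ is a metric injection with $j\circ P\in\mathcal{Q}(^mE;G)$. The ideal of $m$-homogeneous polynomials $\mathcal{Q}_m$ is injective if this condition holds for that fixed $m$ (and all $E,F,G$). An operator ideal $\mathcal{I}$ is injective if $u\in\mathcal{I}(E;F)$ whenever $u\in\mathcal{L}(E;F)$ and $j\colon F\to G$ is a metric injection with $j\circ u\in\mathcal{I}(E;G)$. *)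

(* Defs.v *)
From HB Require Import structures.
From mathcomp Require Import all_boot all_order all_algebra.
From mathcomp Require Import classical_sets functions reals topology normedtype.
From mathcomp Require Import complex.

Set Implicit Arguments.
Unset Strict Implicit.
Unset Printing Implicit Defensive.

Import Order.TTheory GRing.Theory Num.Theory numFieldNormedType.Exports.

Local Open Scope classical_set_scope.
Local Open Scope ring_scope.

Variant scalars := RealScalars | ComplexScalars.

Definition scalar_field (R : realType) (s : scalars) : numFieldType :=
  match s with
  | RealScalars => R
  | ComplexScalars => R[i]
  end.

(* For K = R[i] the norm takes its values in the (partially ordered) field K,
   so the inequality forces M * `|x| to be real. *)
Definition bounded_operator (K : numFieldType) (E F : normedModType K) :
    set (E -> F) :=
  [set u | linear u /\ exists M : K, forall x, `|u x| <= M * `|x|].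

Definition dual (K : numFieldType) (E : normedModType K) : set (E -> K^o) :=
  @bounded_operator K E K^o.

Definition finite_rank (K : numFieldType) (E F : normedModType K) :
    set (E -> F) :=
  [set u | bounded_operator u /\
    exists (n : nat) (y : 'I_n -> F),
      forall x, exists c : 'I_n -> K, u x = \sum_(i < n) c i *: y i].

Definition metric_injection (K : numFieldType) (F G : normedModType K) :
    set (F -> G) :=
  [set j | linear j /\ forall y, `|j y| = `|y|].

Definition multilinear (K : numFieldType) (m : nat) (E F : normedModType K)
    (A : ('I_m -> E) -> F) : Prop :=
  forall (i : 'I_m) (x : 'I_m -> E), linear (fun y : E => A [eta x with i |-> y]).

Definition homogeneous_poly (K : numFieldType) (m : nat)
    (E F : normedModType K) : set (E -> F) :=
  [set P | (exists2 A : ('I_m -> E) -> F,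
              multilinear A & forall x, P x = A (fun=> x)) /\
           continuous P].

Definition finite_type_poly (K : numFieldType) (m : nat)
    (E F : normedModType K) : set (E -> F) :=
  [set P | exists (n : nat) (phi : 'I_n -> E -> K^o) (y : 'I_n -> F),
     (forall i, dual (phi i)) /\
     forall x, P x = \sum_(i < n) (phi i x : K) ^+ m *: y i].

Definition linear_subspace (K : numFieldType) (V : lmodType K) (A : set V) :
    Prop :=
  A 0 /\ forall (a : K) (u v : V), A u -> A v -> A (a *: u + v).

Definition mapping_class (K : numFieldType) : Type :=
  forall E F : completeNormedModType K, set (E -> F).

(* A class of homogeneous polynomials is given by its components, the first
   argument being the degree; only degrees m >= 1 are ever considered. *)
Definition poly_class (K : numFieldType) : Type := nat -> mapping_class K.

Definition operator_ideal (K : numFieldType) (I : mapping_class K) : Prop :=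
  [/\ forall E F : completeNormedModType K, I E F `<=` @bounded_operator K E F,
      forall E F : completeNormedModType K, linear_subspace (I E F),
      forall E F : completeNormedModType K, @finite_rank K E F `<=` I E F &
      forall (E F G H : completeNormedModType K)
        (t : G -> H) (v : F -> G) (u : E -> F),
        bounded_operator t -> I F G v -> bounded_operator u ->
        I E H (t \o v \o u)].

Definition poly_ideal (K : numFieldType) (Q : poly_class K) : Prop :=
  forall m : nat, (0 < m)%N ->
  [/\ forall E F : completeNormedModType K,
        Q m E F `<=` @homogeneous_poly K m E F,
      forall E F : completeNormedModType K, linear_subspace (Q m E F),
      forall E F : completeNormedModType K,
        @finite_type_poly K m E F `<=` Q m E F &
      forall (E F G H : completeNormedModType K)
        (t : G -> H) (P : F -> G) (u : E -> F),
        bounded_operator t -> Q m F G P -> bounded_operator u ->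
        Q m E H (t \o P \o u)].

Definition poly_hyper_ideal (K : numFieldType) (Q : poly_class K) : Prop :=
  poly_ideal Q /\
  forall m n : nat, (0 < m)%N -> (0 < n)%N ->
  forall (E F G H : completeNormedModType K)
    (t : G -> H) (P : F -> G) (S : E -> F),
    bounded_operator t -> Q m F G P -> homogeneous_poly n S ->
    Q (m * n)%N E H (t \o P \o S).

Definition ideal_of_homogeneous_polys (K : numFieldType) (m : nat)
    (C : mapping_class K) : Prop :=
  exists2 Q : poly_class K, poly_ideal Q &
    forall E F : completeNormedModType K, C E F = Q m E F.

Definition injective_operators (K : numFieldType) (I : mapping_class K) :
    Prop :=
  forall (E F G : completeNormedModType K) (u : E -> F) (j : F -> G),
    bounded_operator u -> metric_injection j -> I E G (j \o u) -> I E F u.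

Definition injective_polys (K : numFieldType) (m : nat) (C : mapping_class K) :
    Prop :=
  forall (E F G : completeNormedModType K) (P : E -> F) (j : F -> G),
    homogeneous_poly m P -> metric_injection j -> C E G (j \o P) -> C E F P.

Definition injective_operator_ideal (K : numFieldType) (I : mapping_class K) :
    Prop :=
  operator_ideal I /\ injective_operators I.

Definition injective_poly_hyper_ideal (K : numFieldType) (Q : poly_class K) :
    Prop :=
  poly_hyper_ideal Q /\ forall m : nat, (0 < m)%N -> injective_polys m (Q m).

Definition injective_ideal_of_homogeneous_polys (K : numFieldType) (m : nat)
    (C : mapping_class K) : Prop :=
  ideal_of_homogeneous_polys m C /\ injective_polys m C.

Definition composition_ideal (K : numFieldType) (I : mapping_class K) :
    poly_class K :=
  fun m E F => [set P | homogeneous_poly m P /\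
    exists (G : completeNormedModType K) (Q : E -> G) (u : G -> F),
      [/\ homogeneous_poly m Q, I G F u & P = u \o Q]].

(* Main.v *)
(* A homogeneous polynomial is the diagonal of its polarization, a multilinear
   map given by a signed sum of its values; hence polarization commutes with
   linear maps and preserves continuity, which replaces the linearization
   through symmetric tensor products.

   (a) => (b).  If j o P = u o Q with u in I(H; F'), let S be the kernel of
   (h, f) |-> u h - j f in H * F, a Banach space.  The polynomial (Q, P) takes
   its values in S, and so does its polarization.  On S one has
   j o pr2 = u o pr1, so pr2 is in I by injectivity, and P = pr2 o (Q, P).

   (c) => (a).  If j o u is in I, the polynomial P (e, t) = t^(m-1) u e on E * K
   satisfies j o P = (j o u) o (t^(m-1) e), so P = v o Q with v in I.
   Polarizing at ((e, 0), (0, 1), ..., (0, 1)) turns P into a nonzero multiple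
   of u and Q into a bounded operator T, so u is a multiple of v o T.  The extra
   factor K makes the Hahn-Banach theorem unnecessary. *)
From HB Require Import structures.
Require Import Defs.
From mathcomp Require Import all_boot all_order all_algebra.
From mathcomp Require Import classical_sets functions reals topology normedtype.
From mathcomp Require Import boolp prodnormedzmodule complex.

Set Implicit Arguments.
Unset Strict Implicit.
Unset Printing Implicit Defensive.

Import Order.TTheory GRing.Theory Num.Theory numFieldNormedType.Exports.

Local Open Scope classical_set_scope.
Local Open Scope ring_scope.

(** * Completeness of products of Banach spaces *)

Lemma cauchy_fmap_nonexpansive (K : numDomainType)
    (V W : pseudoMetricNormedZmodType K) (p : V -> W) (F : set_system V) :
  Filter F -> (forall x y, `|p x - p y| <= `|x - y|) ->
  cauchy F -> cauchy (p @ F).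
Proof.
move=> FF p1 /cauchy_ballP Fc; apply/cauchy_ballP => e e0.
rewrite !near_simpl near_map2; apply: filterS (Fc _ e0) => -[x y] /=.
by rewrite -!ball_normE /=; apply: le_lt_trans.
Qed.

Lemma norm_prod_ge (K : numFieldType) (V W : normedModType K) (x : V * W) :
  `|x.1| <= `|x| /\ `|x.2| <= `|x|.
Proof.
(* [K] is only partially ordered, so a maximum bounds both arguments only when they are comparable;
   norms are real, hence comparable. *)
have xr : `|x.1| >=< `|x.2| by rewrite real_comparable ?normr_real.
by rewrite prod_normE !comparable_le_max ?lexx ?orbT.
Qed.

Section ProductComplete.
Variables (K : numFieldType) (V W : completeNormedModType K).
HB.instance Definition _ := NormedModule.on (V * W)%type.

Lemma prod_cauchy_cvg (F : set_system (V * W)) :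
  ProperFilter F -> cauchy F -> cvg F.
Proof.
move=> FF Fc.
have /cauchy_cvg F1 : cauchy (fst @ F).
  apply: (@cauchy_fmap_nonexpansive K (V * W)%type V) Fc => x y.
  exact: (norm_prod_ge (x - y)).1.
have /cauchy_cvg F2 : cauchy (snd @ F).
  apply: (@cauchy_fmap_nonexpansive K (V * W)%type W) Fc => x y.
  exact: (norm_prod_ge (x - y)).2.
apply/cvg_ex; exists (lim (fst @ F), lim (snd @ F)).
(* [cvg_pair] concerns the image of [F] under [x |-> (x.1, x.2)], which is [F] once pairs are
   destructed. *)
apply: cvg_trans (cvg_pair F1 F2) => A.
by rewrite !nbhs_filterE; apply: (@filterS _ F) => -[].
Qed.

HB.instance Definition _ :=
  Uniform_isComplete.Build (V * W)%type prod_cauchy_cvg.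

End ProductComplete.

(** * The kernel of a continuous linear map as a Banach space *)

Section Kernel.
Variables (K : numFieldType) (V : completeNormedModType K).
Variables (W : normedModType K) (w : {linear V -> W}).

Definition ker_pred : {pred V} := [pred x | w x == 0].

Lemma ker_submod_closed : submod_closed ker_pred.
Proof.
split=> [|a x y]; rewrite !inE ?linear0// => /eqP wx /eqP wy.
by rewrite linearP wx wy scaler0 addr0.
Qed.

HB.instance Definition _ :=
  GRing.isSubmodClosed.Build K V ker_pred ker_submod_closed.

(** Continuity is a parameter of the type so that the completeness instance, which rests on the
    kernel being closed, can be attached to it. *)
Definition ker_space (cw : continuous w) := {x : V | x \in ker_pred}.

Variable cw : continuous w.
Local Notation S := (ker_space cw).

HB.instance Definition _ := SubChoice.on S.
HB.instance Definition _ := [SubChoice_isSubLmodule of S by <:].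

Definition ker_norm (x : S) : K := `|val x|.

Lemma ker_normD x y : ker_norm (x + y) <= ker_norm x + ker_norm y.
Proof. by rewrite /ker_norm raddfD ler_normD. Qed.

Lemma ker_normZ l x : ker_norm (l *: x) = `|l| * ker_norm x.
Proof. by rewrite /ker_norm linearZ normrZ. Qed.

Lemma ker_norm0_eq0 x : ker_norm x = 0 -> x = 0.
Proof. by move/normr0_eq0 => x0; apply: val_inj; rewrite x0 raddf0. Qed.

HB.instance Definition _ :=
  Lmodule_isNormed.Build K S ker_normD ker_normZ ker_norm0_eq0.

Lemma ker_cauchy_cvg (F : set_system S) : ProperFilter F -> cauchy F -> cvg F.
Proof.
move=> FF Fc.
have /cauchy_cvg Fv : cauchy ((val : S -> V) @ F).
  by apply: (@cauchy_fmap_nonexpansive K S V) Fc => x y; rewrite -raddfB.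
set l := lim _ in Fv.
(* Along [F] the map [w \o val] is constantly 0 and also tends to [w l]; limits in [W] are
   unique. *)
have kl : l \in ker_pred.
  have : (w \o val) @ F --> w l by apply: cvg_comp Fv _; exact: cw.
  rewrite inE (_ : w \o val = cst 0); last first.
    by apply/funext => -[x kx]; apply/eqP.
  by move=> w0; rewrite (cvg_unique (@norm_hausdorff _ W) w0 (cvg_cst 0)).
apply/cvg_ex; exists (Sub l kl : S).
apply/cvgrPdist_lt => e e0; move/cvgrPdist_lt: Fv => /(_ _ e0).
by apply: filterS.
Qed.

HB.instance Definition _ := Uniform_isComplete.Build S ker_cauchy_cvg.

End Kernel.

(** * Completeness of the scalar field *)

Section ComplexComplete.
Variable R : realType.
Local Open Scope complex_scope.
Implicit Types x y z : R[i].

Lemma normc_ge_Im x : `|complex.Im x|%:C <= `|x|.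
Proof.
by case: x => a b; simpc; rewrite -sqrtr_sqr ler_wsqrtr // lerDr sqr_ge0.
Qed.

(** After squaring, the two sides differ by a nonnegative cross term. *)
Lemma normc_le_ReDIm x : `|x| <= (`|complex.Re x| + `|complex.Im x|)%:C.
Proof.
case: x => a b /=; simpc; rewrite -[leRHS]ger0_norm ?addr_ge0//.
rewrite -sqrtr_sqr ler_wsqrtr// sqrrD !real_normK ?num_real//.
by rewrite lerD2r lerDl mulrn_wge0 ?mulr_ge0.
Qed.

(** Counterpart of [cauchy_fmap_nonexpansive] for a target normed over [R]: a radius in [R] is
    carried to [R[i]]. *)
Lemma cauchy_fmap_real (p : R[i] -> R)
    (F : set_system (R[i] : numFieldType)^o) :
  Filter F -> (forall x y, `|p x - p y|%:C <= `|x - y|) ->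
  cauchy F -> cauchy (p @ F).
Proof.
move=> FF p1 /cauchy_ballP Fc; apply/cauchy_ballP => e e0.
rewrite !near_simpl near_map2.
have : 0 < e%:C by rewrite ltcR.
move=> /Fc; apply: filterS => -[x y] /=.
rewrite -!ball_normE /= -ltcR; exact: le_lt_trans.
Qed.

Lemma complex_cauchy_cvg (F : set_system (R[i] : numFieldType)^o) :
  ProperFilter F -> cauchy F -> cvg F.
Proof.
move=> FF Fc.
have /R_complete FRe : cauchy ((@complex.Re R) @ F).
  apply: cauchy_fmap_real Fc => x y; rewrite -raddfB; exact: normc_ge_Re.
have /R_complete FIm : cauchy ((@complex.Im R) @ F).
  apply: cauchy_fmap_real Fc => x y; rewrite -raddfB; exact: normc_ge_Im.
apply/cvg_ex; exists (lim ((@complex.Re R) @ F) +i* lim ((@complex.Im R) @ F)).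
(* A positive [e] in [R[i]] has imaginary part 0, so its real part can be split in halves, one for
   each coordinate. *)
apply/cvgrPdist_lt => e; rewrite ltcE /= => /andP[/eqP e_im e_re].
have e2 : 0 < complex.Re e / 2 by rewrite divr_gt0.
move/cvgrPdist_lt: FRe => /(_ _ e2) FRe.
move/cvgrPdist_lt: FIm => /(_ _ e2) FIm.
near=> z; apply: le_lt_trans (normc_le_ReDIm _) _.
rewrite ltcE /= e_im eqxx /= (splitr (complex.Re e)) ltrD//.
  by rewrite raddfB/=; near: z.
by rewrite raddfB/=; near: z.
Unshelve. all: by end_near. Qed.
End ComplexComplete.

Lemma scalar_cauchy_cvg (R : realType) (s : scalars)
    (F : set_system (scalar_field R s)^o) :
  ProperFilter F -> cauchy F -> cvg F.
Proof. case: s F => /= F. exact: R_complete. exact: complex_cauchy_cvg. Qed.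

(** * Bounded operators as continuous linear maps *)

Section BoundedOperators.
Variable K : numFieldType.
Implicit Types E F G : normedModType K.

Definition linear_of E F (u : E -> F) (lu : linear u) : {linear E -> F} :=
  HB.pack u (GRing.isLinear.Build K E F *:%R u lu).

Lemma bounded_operatorP E F (u : E -> F) :
  bounded_operator u <-> linear u /\ continuous u.
Proof.
split=> -[lu]; last first.
  move=> cu; split=> //.
  have : continuous (linear_of lu) by [].
  move=> /linear_bounded_continuous/linear_boundedP.
  by move=> /pinfty_ex_gt0[M _ ?]; exists M.
move=> [M uM]; split=> //.
(* [M] may be negative or non-real when the space is trivial. Since [M * |x|] dominates a norm, it
   is its own absolute value, and [M] can be replaced by its absolute value. *)
have uM' x : `|u x| <= `|M| * `|x|.
  rewrite -[`|x|]normr_id -normrM ger0_norm ?uM//.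
  exact: le_trans (uM x).
apply: (@bounded_linear_continuous _ _ _ (linear_of lu)).
apply/linear_boundedP; near=> r => x; apply: le_trans (uM' x) _.
rewrite ler_wpM2r//; near: r; apply: nbhs_pinfty_ge; exact: normr_real.
Unshelve. all: by end_near. Qed.

Lemma bounded_operator_id E : bounded_operator (@id E).
Proof. by apply/bounded_operatorP; split=> // x. Qed.

Lemma bounded_operator_comp E F G (u : E -> F) (v : F -> G) :
  bounded_operator u -> bounded_operator v -> bounded_operator (v \o u).
Proof.
move=> /bounded_operatorP[lu cu] /bounded_operatorP[lv cv].
apply/bounded_operatorP; split=> [a x y|x] /=; first by rewrite lu lv.
by apply: continuous_comp; [exact: cu|exact: cv].
Qed.

Lemma bounded_operator_fst E F : bounded_operator (@fst E F).
Proof. by apply/bounded_operatorP; split=> // x; exact: cvg_fst. Qed.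

Lemma bounded_operator_snd E F : bounded_operator (@snd E F).
Proof. by apply/bounded_operatorP; split=> // x; exact: cvg_snd. Qed.

Lemma bounded_operator_pair E F G (u : E -> F) (v : E -> G) :
  bounded_operator u -> bounded_operator v ->
  bounded_operator (fun x => (u x, v x)).
Proof.
move=> /bounded_operatorP[lu cu] /bounded_operatorP[lv cv].
apply/bounded_operatorP; split=> [a x y|x]; first by rewrite lu lv.
by apply: cvg_pair; [exact: cu|exact: cv].
Qed.

Lemma bounded_operator_scale E (a : K) : bounded_operator (fun x : E => a *: x).
Proof.
apply/bounded_operatorP; split=> [b x y|x].
  by rewrite scalerDr !scalerA mulrC.
exact: scaler_continuous.
Qed.

Lemma metric_injection_bounded E F (j : E -> F) :
  metric_injection j -> bounded_operator j.
Proof. by case=> lj nj; split=> //; exists 1 => x; rewrite nj mul1r. Qed.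

End BoundedOperators.

(** * Multilinear maps and polarization *)

Section Multilinear.
Variable K : numFieldType.
Implicit Types E F G : normedModType K.

Definition subst_slot (T : eqType) (U : Type) (x : T -> U) i (y : U) : T -> U :=
  [eta x with i |-> y].

Lemma subst_slotE (T : eqType) (U : Type) (x : T -> U) i y k :
  subst_slot x i y k = if k == i then y else x k.
Proof. by []. Qed.

Lemma subst_slot_id (T : eqType) (U : Type) (x : T -> U) i :
  subst_slot x i (x i) = x.
Proof. by apply/funext => k; rewrite subst_slotE; case: eqP => [->|]. Qed.

Lemma multilinear_slot0 m E F (A : ('I_m -> E) -> F) x i :
  multilinear A -> x i = 0 -> A x = 0.
Proof.
move=> mA xi; rewrite -(subst_slot_id x i) xi.
by have := raddf0 (linear_of (mA i x)).
Qed.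

Lemma multilinear_slot_sum m E F (A : ('I_m -> E) -> F) (J : finType) x i
    (y : J -> E) : multilinear A ->
  A (subst_slot x i (\sum_j y j)) = \sum_j A (subst_slot x i (y j)).
Proof. by move=> mA; have := raddf_sum (linear_of (mA i x)); apply. Qed.

(* [h k f] expands the first [k] slots along [f]; the sum of [A (h k f)] over
   all [f], times [#|J| ^ k], does not depend on [k], because exchanging [f k]
   with [j] is an involution on the pairs [(j, f)]. *)
Lemma multilinear_sum m E F (A : ('I_m -> E) -> F) (J : finType)
    (y : 'I_m -> J -> E) : (0 < #|J|)%N -> multilinear A ->
  A (fun i => \sum_j y i j) =
  \sum_(f : {ffun 'I_m -> J}) A (fun i => y i (f i)).
Proof.
move=> J_gt0 mA.
pose h k (f : {ffun 'I_m -> J}) (i : 'I_m) :=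
  if (i < k)%N then y i (f i) else \sum_j y i j.
have [A0 A0E] : exists A0, A (fun i => \sum_j y i j) = A0 by eexists.
have [N N_gt0 JN] : exists2 N, (0 < N)%N & #|J| = N by exists #|J|.
have hk k : (k <= m)%N -> (\sum_f A (h k f)) *+ N ^ k = A0 *+ N ^ m.
  elim: k => [|k IHk] km.
    by rewrite /h /= A0E sumr_const card_ffun card_ord JN.
  pose kk := Ordinal km.
  pose upd (f : {ffun 'I_m -> J}) j : {ffun 'I_m -> J} :=
    [ffun i => if i == kk then j else f i].
  have E1 f : A (h k f) = \sum_j A (h k.+1 (upd f j)).
    rewrite -[h k f](subst_slot_id _ kk) {2}/h /= ltnn multilinear_slot_sum//.
    apply: eq_bigr => j _; congr A; apply/funext => i.
    rewrite subst_slotE /h ffunE ltnS [(i <= k)%N]leq_eqVlt.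
    rewrite -[_ == k :> nat]/(i == kk).
    by case: eqVneq => [->|].
  rewrite -(IHk (ltnW km)) expnS mulrnA; congr (_ *+ _).
  under [in RHS]eq_bigr do rewrite E1.
  rewrite exchange_big pair_big /=.
  pose inv (p : J * {ffun 'I_m -> J}) := (p.2 kk, upd p.2 p.1).
  have invK : involutive inv.
    move=> [j f]; rewrite /inv /=; congr pair; first by rewrite ffunE eqxx.
    by apply/ffunP => i; rewrite !ffunE; case: eqP => [->|].
  rewrite [in RHS](reindex_inj (inv_inj invK)) /=.
  under [in RHS]eq_bigr => p _.
    rewrite (_ : upd _ _ = p.2); last first.
      by apply/ffunP => i; rewrite !ffunE; case: eqP => [->|].
    over.
  rewrite -(pair_big xpredT xpredT (fun j f => A (h k.+1 f))) /=.
  by rewrite sumr_const JN.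
have N_neq0 : (N ^ m)%:R != 0 :> K by rewrite pnatr_eq0 -lt0n expn_gt0 N_gt0.
apply: (scalerI N_neq0); rewrite A0E !scaler_nat -(hk m)//.
congr (_ *+ _); apply: eq_bigr => f _; congr A.
by apply/funext => i; rewrite /h ltn_ord.
Qed.

(** Both sides equal the product of the [1 + G i], where [G] is 0 on [B] and -1 off [B]. In its
    expansion [S] records where the term 1 is chosen, and an element of [B] outside [S] contributes
    a factor 0. *)
Lemma alternating_sum_supersets (T : finType) (B : {pred T}) :
  \sum_(S : {set T} | B \subset S) (-1) ^+ #|~: S| =
  [forall i, i \in B]%:R :> K.
Proof.
pose G i : K := if i \in B then 0 else -1.
have -> : [forall i, i \in B]%:R = \prod_i (1 + G i) :> K.
  case: forallP => [BT|/forallP/forallPn[i iB]].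
    by rewrite big1// => i _; rewrite /G BT addr0.
  by rewrite (bigD1 i)//= /G (negPf iB) subrr mul0r.
rewrite bigA_distr big_mkcond; apply: eq_bigr => S _.
case: ifPn => [/fintype.subsetP BS|/subsetPn[i iB iS]]; last first.
  by rewrite (bigD1 i)//= (negPf iS) /G iB mul0r.
rewrite (bigID (mem S))/= big1 => [|i ->//]; rewrite mul1r.
rewrite -prodr_const; apply: eq_big => [i|i]; rewrite inE// => iS.
by rewrite (negPf iS) /G ifN//; apply: contra iS; apply: BS.
Qed.

(** The classical polarization formula. The factor [m!] is written as the number of injective
    self-maps of ['I_m], the index set of the sum in [polarizationE]. *)
Definition polarization m E F (P : E -> F) (x : 'I_m -> E) : F :=
  #|[pred f : {ffun 'I_m -> 'I_m} | injectiveb f]|%:R^-1 *: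
  \sum_(S : {set 'I_m}) (-1) ^+ #|~: S| *: P (\sum_(i in S) x i).

Lemma card_injections_neq0 m :
  #|[pred f : {ffun 'I_m -> 'I_m} | injectiveb f]|%:R != 0 :> K.
Proof.
rewrite pnatr_eq0 -lt0n; apply/card_gt0P; exists [ffun i => i].
by rewrite inE; apply/injectiveP => i j; rewrite !ffunE.
Qed.

Lemma polarization_linear m E F G (u : F -> G) (P : E -> F) (x : 'I_m -> E) :
  linear u -> polarization (u \o P) x = u (polarization P x).
Proof.
move=> lu; rewrite -[u]/(linear_of lu : F -> G) [RHS]linearZ linear_sum.
congr (_ *: _).
by apply: eq_bigr => S _; rewrite linearZ.
Qed.

(** Multilinearity expands the value at the sum over [S] into the terms [A (x \o f)] with the image
    of [f] inside [S]. After exchanging sums, [A (x \o f)] has as coefficient the alternating sum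
    over the supersets of that image, which vanishes unless [f] is onto, that is, injective. *)
Lemma polarizationE m E F (A : ('I_m -> E) -> F) (x : 'I_m -> E) :
  (0 < m)%N -> multilinear A ->
  polarization (fun y => A (fun=> y)) x =
  #|[pred f : {ffun 'I_m -> 'I_m} | injectiveb f]|%:R^-1 *:
  \sum_(f in [pred f : {ffun 'I_m -> 'I_m} | injectiveb f]) A (x \o f).
Proof.
move=> m0 mA; congr (_ *: _).
have expand (S : {set 'I_m}) : A (fun=> \sum_(i in S) x i) =
    \sum_(f : {ffun 'I_m -> 'I_m} | codom f \subset S) A (x \o f).
  rewrite (_ : (fun=> _) = fun=> \sum_j if j \in S then x j else 0); last first.
    by apply/funext => _; rewrite big_mkcond.
  rewrite multilinear_sum ?card_ord// [RHS]big_mkcond.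
  apply: eq_bigr => f _.
  case: ifPn => [/fintype.subsetP fS|/subsetPn[_ /codomP[i ->] fiS]].
    congr A; apply/funext => i /=; rewrite ifT//.
    by apply: fS; apply: codom_f.
  by apply: (multilinear_slot0 (i := i)) => //; rewrite (negPf fiS).
under eq_bigr do rewrite expand scaler_sumr.
rewrite (exchange_big_dep xpredT)//= [RHS]big_mkcond; apply: eq_bigr => f _.
rewrite -scaler_suml alternating_sum_supersets.
rewrite inE; have -> : [forall i, i \in codom f] = injectiveb f.
  apply/forallP/injectiveP => [f_onto|/injF_onto//].
  (* The list [codom f] has length [m] and contains all [m] indices, so it has no repetition. *)
  apply/injectiveP; rewrite -[injectiveb _]/(uniq (codom f)).
  apply: (leq_size_uniq (enum_uniq 'I_m)) => [i _|]; last by rewrite size_map.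
  exact: f_onto.
by case: ifP; rewrite ?scale1r ?scale0r.
Qed.

Lemma polarization_diag m E F (A : ('I_m -> E) -> F) (x : E) :
  (0 < m)%N -> multilinear A ->
  polarization (m := m) (fun y => A (fun=> y)) (fun=> x) = A (fun=> x).
Proof.
move=> m0 mA; rewrite polarizationE// (eq_bigr (fun=> A (fun=> x)))//.
rewrite sumr_const -[X in _ *: X]scaler_nat scalerA.
by rewrite mulVf ?scale1r// card_injections_neq0.
Qed.

(** The polarization averages [A (x \o f)] over permutations [f], and changing slot [i] of [x]
    changes [x \o f] only in the slot that [f] sends to [i]. *)
Lemma multilinear_polarization m E F (A : ('I_m -> E) -> F) :
  (0 < m)%N -> multilinear A ->
  multilinear (polarization (m := m) (fun y => A (fun=> y))).
Proof.
move=> m0 mA i x a y z; rewrite !polarizationE//.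
rewrite scalerA mulrC -scalerA -scalerDr; congr (_ *: _).
rewrite scaler_sumr -big_split; apply: eq_bigr => f /=.
rewrite inE => /injectiveP f_inj.
have slotE w : [eta x with i |-> w] \o f = subst_slot (x \o f) (invF f_inj i) w.
  by apply/funext => k; rewrite subst_slotE /= -(inj_eq f_inj) f_invF.
by rewrite !slotE; apply: mA.
Qed.
End Multilinear.

(** * Continuous homogeneous polynomials *)

Section HomogeneousPolynomials.
Variable K : numFieldType.
Implicit Types E F G : normedModType K.

Lemma homogeneous_poly_bounded E F (u : E -> F) :
  bounded_operator u -> homogeneous_poly 1 u.
Proof.
move=> /bounded_operatorP[lu cu]; split=> //.
exists (fun x => u (x ord0)) => // i x; rewrite (ord1 i) => a y z /=.
exact: lu.
Qed.

Lemma mxvec_index_eq m n (i i' : 'I_m) (j j' : 'I_n) :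
  (mxvec_index i j == mxvec_index i' j') = (i == i') && (j == j').
Proof.
by rewrite /mxvec_index (inj_eq (@cast_ord_inj _ _ _)) (inj_eq enum_rank_inj).
Qed.

(** The [m * n] slots are arranged as a matrix: row [i] feeds [B], whose value enters slot [i] of
    [A]. Changing entry [(i, j)] affects row [i] alone. *)
Lemma homogeneous_poly_comp m n E F G (P : F -> G) (Q : E -> F) :
  homogeneous_poly m P -> homogeneous_poly n Q ->
  homogeneous_poly (m * n) (P \o Q).
Proof.
move=> [[A mA PA] cP] [[B mB QB] cQ]; split; last first.
  by move=> x; apply: continuous_comp; [exact: cQ|exact: cP].
exists (fun x => A (fun i => B (fun j => x (mxvec_index i j)))); last first.
  by move=> x /=; rewrite PA QB.
move=> k x; case/mxvec_indexP: k => i j.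
have slotE w :
    (fun i' => B (fun j' =>
       [eta x with mxvec_index i j |-> w] (mxvec_index i' j'))) =
    subst_slot (fun i' => B (fun j' => x (mxvec_index i' j'))) i
      (B (subst_slot (fun j' => x (mxvec_index i j')) j w)).
  apply/funext => i'; rewrite subst_slotE; case: (eqVneq i' i) => [->|ni].
    by congr B; apply/funext => j'; rewrite /= mxvec_index_eq eqxx.
  by congr B; apply/funext => j' /=; rewrite mxvec_index_eq (negPf ni).
by move=> a y z; rewrite !slotE mB mA.
Qed.

Lemma homogeneous_poly_bounded_comp m E F G (u : F -> G) (P : E -> F) :
  bounded_operator u -> homogeneous_poly m P -> homogeneous_poly m (u \o P).
Proof.
move=> /homogeneous_poly_bounded hu hP; rewrite -[m]mul1n.
exact: homogeneous_poly_comp.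
Qed.

Lemma homogeneous_poly_comp_bounded m E F G (P : F -> G) (u : E -> F) :
  homogeneous_poly m P -> bounded_operator u -> homogeneous_poly m (P \o u).
Proof.
move=> hP /homogeneous_poly_bounded hu; rewrite -[m]muln1.
exact: homogeneous_poly_comp.
Qed.

Lemma homogeneous_poly0 m E F : homogeneous_poly m (fun _ : E => 0 : F).
Proof.
split; last by move=> x; exact: cvg_cst.
by exists (fun=> 0) => // i x a y z; rewrite scaler0 addr0.
Qed.

Lemma homogeneous_poly_pair m E F G (P : E -> F) (Q : E -> G) :
  homogeneous_poly m P -> homogeneous_poly m Q ->
  homogeneous_poly m (fun x => (P x, Q x)).
Proof.
move=> [[A mA PA] cP] [[B mB QB] cQ]; split; last first.
  by move=> x; apply: cvg_pair; [exact: cP|exact: cQ].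
exists (fun x => (A x, B x)) => [i x a y z|x]; last by rewrite PA QB.
by rewrite mA mB.
Qed.

(** A non-symmetric multilinear map with diagonal [t ^ n *: e] at [(e, t)]; reserving slot 0 for the
    vector makes its symmetrization easy to evaluate. *)
Definition power_scale_form n E (x : 'I_n.+1 -> E * K^o) : E :=
  (\prod_(i < n) (x (lift ord0 i)).2 : K) *: (x ord0).1.

Lemma multilinear_power_scale n E : multilinear (@power_scale_form n E).
Proof.
move=> k x a y z; rewrite /power_scale_form.
case: (unliftP ord0 k) => [i ->|->] /=.
  have slotE (w : E * K^o) :
      (\prod_(l < n)
         (if lift ord0 l == lift ord0 i then w else x (lift ord0 l)).2 : K) =
      w.2 * (\prod_(l < n | l != i) (x (lift ord0 l)).2 : K).
    rewrite (bigD1 i)//= eqxx; congr (_ * _); apply: eq_bigr => l /negPf li.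
    by rewrite (inj_eq lift_inj) li.
  by rewrite !slotE /= mulrDl scalerDl scalerA mulrA.
by rewrite /= scalerDr !scalerA mulrC.
Qed.

Lemma homogeneous_power_scale n E :
  homogeneous_poly n.+1 (fun p : E * K^o => (p.2 : K) ^+ n *: p.1).
Proof.
split.
  exists (@power_scale_form n E); first exact: multilinear_power_scale.
  by move=> x; rewrite /power_scale_form prodr_const card_ord.
move=> p; apply: cvgZ; last exact: cvg_fst.
elim: n => [|n IHn]; first exact: cvg_cst.
under eq_fun do rewrite exprS.
by rewrite exprS; apply: cvgM; [exact: cvg_snd|exact: IHn].
Qed.

(** The power is the polynomial [t ^ n *: e] over [K] restricted to the diagonal [e = t], with [n]
    one less than the degree. *)
Lemma homogeneous_power m : (0 < m)%N ->
  homogeneous_poly m (fun t : K^o => (t : K) ^+ m : K^o).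
Proof.
case: m => // m _.
have -> : (fun t : K^o => (t : K) ^+ m.+1 : K^o) =
    (fun p : K^o * K^o => (p.2 : K) ^+ m *: p.1) \o (fun t => (t, t)).
  by apply/funext => t; rewrite /= exprSr.
apply: homogeneous_poly_comp_bounded; first exact: homogeneous_power_scale.
exact: (bounded_operator_pair (bounded_operator_id _) (bounded_operator_id _)).
Qed.

Lemma continuous_sum (T : topologicalType) E (J : Type) (r : seq J) (p : pred J)
    (f : J -> T -> E) : (forall i, p i -> continuous (f i)) ->
  continuous (fun x => \sum_(i <- r | p i) f i x).
Proof. apply: continuous_big; exact: add_continuous. Qed.

Lemma continuous_polarization m E F G (P : E -> F) (x : G -> 'I_m -> E) :
  continuous P -> (forall i, continuous (x^~ i)) ->
  continuous (fun z => polarization P (x z)).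
Proof.
move=> cP cx z; apply: cvgZr; apply: continuous_sum => S _ {}z; apply: cvgZr.
apply: (@continuous_comp _ _ _ (fun z => \sum_(i in S) x z i) P).
  by apply: continuous_sum => i _; exact: cx.
exact: cP.
Qed.

End HomogeneousPolynomials.

(** * Composition ideals are polynomial hyper-ideals *)

Section CompositionIdeal.
Variable K : numFieldType.
Hypothesis K_complete :
  forall F : set_system K^o, ProperFilter F -> cauchy F -> cvg F.
Variable I : mapping_class K.
Hypothesis I_ideal : operator_ideal I.
Implicit Types E F G H : completeNormedModType K.

Definition scalar_banach : completeNormedModType K :=
  HB.pack K^o (Uniform_isComplete.Build K^o K_complete).

Lemma operator_ideal_bounded E F (u : E -> F) : I u -> bounded_operator u.
Proof. by case: I_ideal => + _ _ _; apply. Qed.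

Lemma operator_ideal_compl E F G (t : F -> G) (u : E -> F) :
  bounded_operator t -> I u -> I (t \o u).
Proof.
move=> bt Iu; case: I_ideal => _ _ _ /(_ _ _ _ _ _ _ id bt Iu); apply.
exact: bounded_operator_id.
Qed.

Lemma operator_ideal_compr E F G (v : F -> G) (u : E -> F) :
  I v -> bounded_operator u -> I (v \o u).
Proof.
move=> Iv bu; case: I_ideal => _ _ _ /(_ _ _ _ _ id v u); apply=> //.
exact: bounded_operator_id.
Qed.

Lemma composition_ideal_intro m E F G (Q : E -> G) (u : G -> F) :
  homogeneous_poly m Q -> I u -> composition_ideal I m (u \o Q).
Proof.
move=> hQ Iu; split; last by exists G, Q, u.
exact: homogeneous_poly_bounded_comp (operator_ideal_bounded Iu) hQ.
Qed.

(** A combination of [u1 \o Q1] and [u2 \o Q2] factors through the product [G1 * G2], by way of the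
    pair [(Q1, Q2)]. *)
Lemma composition_ideal_subspace m E F :
  linear_subspace (@composition_ideal K I m E F).
Proof.
case: I_ideal => _ Isub _ _; split.
  rewrite (_ : 0 = (0 : F -> F) \o (fun _ : E => 0 : F)); last by apply/funext.
  apply: composition_ideal_intro; first exact: homogeneous_poly0.
  exact: (Isub F F).1.
move=> a _ _ [_ [G1 [Q1 [u1 [hQ1 Iu1 ->]]]]] [_ [G2 [Q2 [u2 [hQ2 Iu2 ->]]]]].
rewrite (_ : a *: _ + _ =
  (a *: (u1 \o @fst G1 G2) + (u2 \o @snd G1 G2)) \o (fun x => (Q1 x, Q2 x))).
  apply: (@composition_ideal_intro m E F (G1 * G2)%type).
    exact: homogeneous_poly_pair.
  apply: (Isub _ _).2; apply: operator_ideal_compr => //.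
    exact: bounded_operator_fst.
  exact: bounded_operator_snd.
by apply/funext.
Qed.

Lemma composition_ideal_comp m n E F G H (t : G -> H) (P : F -> G)
    (Q : E -> F) :
  bounded_operator t -> composition_ideal I m P -> homogeneous_poly n Q ->
  composition_ideal I (m * n) (t \o P \o Q).
Proof.
move=> bt [_ [G' [Q' [u [hQ' Iu ->]]]]] hQ.
rewrite (_ : _ \o _ = (t \o u) \o (Q' \o Q)) //.
apply: composition_ideal_intro; first exact: homogeneous_poly_comp.
exact: operator_ideal_compl.
Qed.

(** Each summand factors through the scalar field as the polynomial [phi i x ^+ m] followed by the
    rank-one operator [t |-> t *: y i]. *)
Lemma composition_ideal_finite_type m E F : (0 < m)%N ->
  @finite_type_poly K m E F `<=` @composition_ideal K I m E F.
Proof.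
move=> m0 P [n [phi [y [dphi Py]]]].
have -> : P = \sum_(i < n) (fun x => (phi i x : K) ^+ m *: y i).
  by apply/funext => x; rewrite Py fct_sumE.
have [sub0 subD] := @composition_ideal_subspace m E F.
elim/big_rec: _ => // i P' _ IP'.
rewrite -[X in X + _]scale1r; apply: subD => //.
rewrite (_ : (fun x => _) =
  (fun t : scalar_banach => (t : K) *: y i) \o
  ((fun t : scalar_banach => (t : K) ^+ m : scalar_banach) \o phi i)) //.
apply: (@composition_ideal_intro m E F scalar_banach).
  apply: (@homogeneous_poly_comp_bounded K m E scalar_banach scalar_banach).
    exact: homogeneous_power.
  exact: dphi.
case: I_ideal => _ _ frI _; apply: (frI scalar_banach F); split.
  split; first by move=> a s t; rewrite scalerDl scalerA.
  by exists `|y i| => t; rewrite normrZ mulrC.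
by exists 1%N, (fun=> y i) => t; exists (fun=> t); rewrite big_ord1.
Qed.

Lemma composition_ideal_poly_ideal : poly_ideal (composition_ideal I).
Proof.
move=> m m0; split.
- by move=> E F P [].
- exact: composition_ideal_subspace.
- by move=> E F; exact: composition_ideal_finite_type.
- move=> E F G H t P u bt hP bu; rewrite -[m]muln1.
  by apply: composition_ideal_comp => //; exact: homogeneous_poly_bounded.
Qed.

Lemma composition_ideal_hyper_ideal : poly_hyper_ideal (composition_ideal I).
Proof.
split; first exact: composition_ideal_poly_ideal.
move=> m n _ _ E F G H t P S; exact: composition_ideal_comp.
Qed.

(** * Transfer of injectivity between an operator ideal and its composition ideal *)

Lemma composition_ideal_injective m : (0 < m)%N -> injective_operators I ->
  injective_polys m (composition_ideal I m).
Proof.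
move=> m0 inj_I E F G P j hP jinj [_ [H [Q [u [hQ Iu jP]]]]].
have [lj cj] := (bounded_operatorP j).1 (metric_injection_bounded jinj).
have [lu cu] := (bounded_operatorP u).1 (operator_ideal_bounded Iu).
pose w (p : H * F) := u p.1 - j p.2.
have lw : linear w.
  by move=> a p q; rewrite /w lu lj scalerBr opprD addrACA.
have cw : continuous (linear_of lw).
  move=> p; apply: cvgB.
    by apply: (continuous_comp (g := u)); [exact: cvg_fst|exact: cu].
  by apply: (continuous_comp (g := j)); [exact: cvg_snd|exact: cj].
pose S : completeNormedModType K := ker_space cw.
have bval : bounded_operator (val : S -> H * F).
  split; first by move=> a x y; rewrite linearP.
  by exists 1 => x; rewrite mul1r.
have [[[A mA QA] cQ] [[B mB PB] cP]] := (hQ, hP).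
have QE : Q = fun x => A (fun=> x) by apply/funext.
have PE : P = fun x => B (fun=> x) by apply/funext.
(* Polarization commutes with [u] and [j], so [j \o P = u \o Q] holds for the polarized maps at
   every tuple, off the diagonal too. Thus [R] below is a multilinear map into [S]. *)
have polS (x : 'I_m -> E) :
    (polarization Q x, polarization P x) \in ker_pred (linear_of lw).
  rewrite inE /= /w /= -(polarization_linear Q x lu).
  by rewrite -(polarization_linear P x lj) jP subrr.
pose R x : S := exist _ (polarization Q x, polarization P x) (polS x).
pose Q' (x : E) : S := R (fun=> x).
have valQ' x : val (Q' x) = (Q x, P x).
  by rewrite /Q' /= {1}QE {1}PE !polarization_diag// -QA -PB.
have hQ' : homogeneous_poly m Q'.
  split.
    exists R => // i x a y z; apply: val_inj.
    rewrite linearP /= QE PE.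
    rewrite (multilinear_polarization m0 mA).
    by rewrite (multilinear_polarization m0 mB).
  (* The inclusion of [S] is isometric, so [Q'] inherits continuity from the pair [(Q, P)]. *)
  move=> x; apply/cvgrPdist_lt => e e0.
  have : (fun y => (Q y, P y)) @ x --> (Q x, P x).
    by apply: cvg_pair; [exact: cQ|exact: cP].
  move/cvgrPdist_lt => /(_ _ e0); apply: filterS => y.
  by rewrite -!valQ' -raddfB.
rewrite (_ : P = (snd \o val) \o Q'); last first.
  by apply/funext => x; rewrite -[RHS]/((val (Q' x)).2) valQ'.
apply: (composition_ideal_intro hQ').
apply: (inj_I _ _ _ _ j) => //.
  exact: bounded_operator_comp bval (bounded_operator_snd _ _).
rewrite (_ : j \o _ = u \o (fst \o val)).
  apply: operator_ideal_compr => //.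
  exact: bounded_operator_comp bval (bounded_operator_fst _ _).
apply/funext => x /=; apply/esym/eqP; rewrite -subr_eq0.
exact: valP x.
Qed.

Lemma injective_of_composition_ideal m : (0 < m)%N ->
  injective_polys m (composition_ideal I m) -> injective_operators I.
Proof.
case: m => // n _ inj_P E F G u j bu jinj Iju.
have [lu _] := (bounded_operatorP u).1 bu.
pose X : completeNormedModType K := (E * scalar_banach)%type.
pose Q0 (p : X) : E := (p.2 : K) ^+ n *: p.1.
have hQ0 : homogeneous_poly n.+1 Q0 by exact: (@homogeneous_power_scale K n E).
have [_ [H [Q [v [hQ Iv PvQ]]]]] : composition_ideal I n.+1 (u \o Q0).
  apply: (inj_P _ _ _ _ j) => //; first exact: homogeneous_poly_bounded_comp.
  exact: (composition_ideal_intro hQ0 Iju).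
have [lv _] := (bounded_operatorP v).1 (operator_ideal_bounded Iv).
pose x (e : E) : 'I_n.+1 -> X := subst_slot (fun=> (0, 1)) ord0 (e, 0).
pose T e := polarization Q (x e).
have bT : bounded_operator T.
  apply/bounded_operatorP; have [[A mA QA] cQ] := hQ; split.
    move=> a e f; rewrite /T (_ : Q = fun y => A (fun=> y)); last exact/funext.
    rewrite {1}/x (_ : (a *: e + f, 0) = a *: (e, 0) + (f, 0) :> X).
      exact: (multilinear_polarization (ltn0Sn n) mA).
    by congr pair; rewrite /= ?scaler0 ?addr0.
  (* Slot 0 of [x e] is the bounded operator [e |-> (e, 0)], and every other slot is constant in
     [e]. *)
  apply: continuous_polarization cQ _ => i e.
  rewrite /x; have [->|/negPf i0] := eqVneq i ord0.
    have /bounded_operatorP[_] : bounded_operator (fun f : E => (f, 0 : K^o)).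
      apply: bounded_operator_pair (bounded_operator_id _) _.
      split=> [a f g|]; first by rewrite scaler0 addr0.
      by exists 0 => f; rewrite mul0r normr0.
    exact.
  by under eq_fun do rewrite subst_slotE i0; exact: cvg_cst.
have [c c0 polQ0] :
    exists2 c : K, c != 0 & forall e, polarization Q0 (x e) = c *: e.
  pose B := [pred f : {ffun 'I_n.+1 -> 'I_n.+1} | injectiveb f].
  pose C := [pred f : {ffun 'I_n.+1 -> 'I_n.+1} | B f && (f ord0 == ord0)].
  (* Only the injections fixing [ord0] contribute: they put [e] in the vector slot and 1 in every
     scalar slot, whereas any other injection puts 0 in the vector slot. The identity shows that [C]
     is nonempty. *)
  exists (#|B|%:R^-1 * #|C|%:R).
    rewrite mulf_neq0 ?invr_eq0 ?card_injections_neq0// pnatr_eq0 -lt0n.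
    apply/card_gt0P; exists [ffun i => i]; rewrite inE /= ffunE eqxx andbT.
    by apply/injectiveP => i k; rewrite !ffunE.
  move=> e.
  have -> : Q0 = fun y => @power_scale_form K n E (fun=> y).
    by apply/funext => p; rewrite /power_scale_form prodr_const card_ord.
  rewrite polarizationE//; last exact: multilinear_power_scale.
  rewrite -scalerA scaler_nat -[e *+ _]sumr_const; congr (_ *: _).
  rewrite big_mkcond [RHS]big_mkcond; apply: eq_bigr => f _; rewrite !inE.
  case: injectiveP => //= f_inj; rewrite /power_scale_form /= /x.
  rewrite [in X in _ *: X]subst_slotE; case: eqP => f0; last by rewrite scaler0.
  rewrite big1 ?scale1r// => i _; rewrite subst_slotE ifN//.
  by rewrite -[X in _ == X]f0 (inj_eq f_inj).
(* [v (T e)] is the polarization of [v \o Q = u \o Q0] at [x e], hence equals [u (c *: e)]. *)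
have -> : u = v \o (T \o (fun e => c^-1 *: e)).
  apply/funext => e /=; rewrite /T -polarization_linear// -PvQ.
  by rewrite polarization_linear// polQ0 scalerA mulfV// scale1r.
apply: operator_ideal_compr => //.
exact: bounded_operator_comp (bounded_operator_scale _ _) bT.
Qed.

End CompositionIdeal.

Theorem corollary3p6 (R : realType) (s : scalars)
    (I : mapping_class (scalar_field R s)) :
  operator_ideal I ->
  [<-> injective_operator_ideal I;
       injective_poly_hyper_ideal (composition_ideal I);
       exists2 m : nat, (0 < m)%N &
         injective_ideal_of_homogeneous_polys m (composition_ideal I m)].
Proof.
move=> I_ideal; have K_complete := @scalar_cauchy_cvg R s.
tfae.
- move=> [_ inj_I]; split; first exact: composition_ideal_hyper_ideal.
  by move=> m m0; exact: composition_ideal_injective.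
(* Injectivity holds in every positive degree; degree 1 is taken as the witness. *)
- move=> [[IP_ideal _] inj_IP]; exists 1%N => //.
  by split; [exists (composition_ideal I)|exact: inj_IP].
- move=> [m m0 [_ inj_m]]; split => //.
  exact: (injective_of_composition_ideal K_complete I_ideal m0 inj_m).
Qed.
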